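(* Let $d$ be a positive integer, let $w_1,w_2,\dots$ be an infinite sequence of non-negative integers, and suppose that $u=1$. For any partition $\lambda\in\mathcal{P}(d)$ we have $s^w_\lambda(x)\in\mathbb{Z}[x]^{\mathfrak{S}_d}$. Moreover, there exists a representation $V^\lambda_w$ of $\mathrm{GL}_d(\mathbb{C})$ such that $s^w_\lambda(x)$ is the character $\mathrm{ch}(V^\lambda_w)$ of $V^\lambda_w$.
   Context: $\mathcal{P}(d)$ is the set of partitions $\lambda=(\lambda_1\ge\dots\ge\lambda_d\ge0)$ with at most $d$ rows; put $\bar\lambda_i=\lambda_i+d+1-i$. $\mathbb{Z}[x]^{\mathfrak{S}_d}$ is the ring of symmetric polynomials in $x_1,\dots,x_d$ with integer coefficients. The factorial Schur polynomial in $x_1,\dots,x_d$ and indeterminates $a=(a_1,a_2,\dots)$ is $$s_\lambda(x|a)=\frac{\det\big[\prod_{p=1}^{\bar\lambda_i-1}(x_j-a_p)\big]_{1\le i,j\le d}}{\prod_{1\le i<j\le d}(x_i-x_j)}.$$ For a positive integer $u$, the twisted Schur polynomial $s^w_\lambda(x)\in\mathbb{Q}[x]^{\mathfrak{S}_d}$ is obtained from $s_\lambda(x|a)$ by substituting $a_l=-(w_l/u)(x_1+\dots+x_d)$ for all $l\ge1$. Representations are finite-dimensional algebraic representations; the character of a representation is the trace of $\mathrm{diag}(x_1,\dots,x_d)$, so that the irreducible representation $V^\lambda$ of $\mathrm{GL}_d(\mathbb{C})$ with highest weight $\lambda$ has character the Schur polynomial $s_\lambda(x)$. *)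

(* Defs.v *)
From HB Require Import structures.
From mathcomp Require Export all_boot all_order all_algebra.
From mathcomp Require Export complex reals.
From mathcomp Require Export mpoly.

Set Implicit Arguments.
Unset Strict Implicit.
Unset Printing Implicit Defensive.

Export GRing.Theory.

Local Open Scope ring_scope.

(* Newton interpolation at the nodes x 0, x 1, ... *)
Lemma newton_interpolation (A : comNzRingType) (x : nat -> A) (f : {poly A})
    (n : nat) : exists c : nat -> A, forall j, (j < n)%N ->
  f.[x j] = \sum_(k < n) c k * \prod_(l < k) (x j - x l).
Proof.
suff [c [q cq]] : exists (c : nat -> A) (q : {poly A}), forall y,
    f.[y] = \sum_(k < n) c k * \prod_(l < k) (y - x l)
            + q.[y] * \prod_(l < n) (y - x l).
  exists c => j ltjn; rewrite cq [X in _ * X](bigD1 (Ordinal ltjn)) //=.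
  by rewrite subrr mul0r mulr0 addr0.
elim: n => [|n [c [q cq]]].
  by exists (fun=> 0), f => y; rewrite !big_ord0 add0r mulr1.
have /factor_theorem[r qr] : root (q - q.[x n]%:P) (x n).
  by rewrite /root !hornerE subrr.
exists (fun k => if k == n then q.[x n] else c k), r => y.
rewrite cq !big_ord_recr /= eqxx -addrA; congr (_ + _).
  by apply: eq_bigr => k _; rewrite (ltn_eqF (ltn_ord k)).
have -> : q.[y] = r.[y] * (y - x n) + q.[x n].
  by apply/eqP; rewrite -subr_eq -[X in _ - X](hornerC _ y) -hornerN -hornerD qr
    !hornerE.
by rewrite mulrDl addrC -mulrA [(y - x n) * _]mulrC.
Qed.

Lemma det_horner_divisible (A : comNzRingType) (n : nat)
    (f : 'I_n -> {poly A}) (x : 'I_n -> A) :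
  exists r, \det (\matrix_(i, j) (f i).[x j])
            = r * \prod_(i < n) \prod_(j < n | (i < j)%N) (x i - x j).
Proof.
pose xx k := odflt 0 (omap x (insub k)).
have xxE (i : 'I_n) : xx i = x i by rewrite /xx valK.
have /fin_all_exists[c cP] := fun i => newton_interpolation xx (f i) n.
pose N := \matrix_(j < n, k < n) \prod_(l < k) (xx j - xx l).
have -> : \matrix_(i, j) (f i).[x j] = (\matrix_(i, k < n) c i k) *m N^T.
  apply/matrixP => i j; rewrite !mxE -xxE cP //.
  by apply: eq_bigr => k _; rewrite !mxE.
have trigN : is_trig_mx N.
  apply/is_trig_mxP => i j ltij; rewrite mxE (bigD1 (Ordinal ltij)) //=.
  by rewrite subrr mul0r.
rewrite det_mulmx det_tr (det_trig trigN).
set C := \det _.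
exists (C * \prod_(i < n) \prod_(j < n | (i < j)%N) -1).
rewrite -mulrA; congr (_ * _).
rewrite -big_split /=.
under [RHS]eq_bigr => i _ do rewrite -big_split /=.
rewrite [RHS](exchange_big_dep predT) //=; apply: eq_bigr => j _.
rewrite mxE (big_ord_widen_cond _ predT (fun l => xx j - xx l) (ltnW (ltn_ord j))) /=.
by apply: eq_bigr => i _; rewrite !xxE mulN1r opprB.
Qed.

Section TwistedSchur.

Variable d : nat.

(* A partition with at most d rows is a nonincreasing [lam : d.-tuple nat],
   padded with zeros.  Rows, variables x, indeterminates a and weights w are all
   indexed from 0: [tnth lam i], ['X_i], [w l] stand for
   lambda_{i+1}, x_{i+1}, w_{l+1}. *)
Implicit Types lam : d.-tuple nat.

(* lambda_{i+1} + d + 1 - (i+1) *)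
Definition bar_part lam (i : 'I_d) : nat := (tnth lam i + d - i)%N.

(* The largest index of an indeterminate a_p occurring in s_lam(x|a), namely
   lambda_1 + d - 1: the finitely many a_1, ..., a_(num_shifts lam) suffice. *)
Definition num_shifts lam : nat := (head 0%N lam + d).-1.

(* Q[x][a]: polynomials in the a_p with coefficients in Q[x]. *)
Local Notation QXA lam := {mpoly {mpoly rat[d]}[num_shifts lam]}.

Definition factorial_schur_num lam : QXA lam :=
  \det (\matrix_(i < d, j < d)
    \prod_(p < num_shifts lam | (p < (bar_part lam i).-1)%N)
      (('X_j : {mpoly rat[d]})%:MP - 'X_p)).

Definition factorial_schur_den lam : QXA lam :=
  \prod_(i < d) \prod_(j < d | (i < j)%N)
    (('X_i : {mpoly rat[d]})%:MP - ('X_j : {mpoly rat[d]})%:MP).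

Lemma factorial_schur_exists lam :
  exists s, s * factorial_schur_den lam == factorial_schur_num lam.
Proof.
pose f (i : 'I_d) : {poly QXA lam} :=
  \prod_(p < num_shifts lam | (p < (bar_part lam i).-1)%N) ('X - ('X_p)%:P).
have [s sP] := det_horner_divisible f
  (fun j => (('X_j : {mpoly rat[d]})%:MP : QXA lam)).
exists s; apply/eqP; rewrite -sP; congr (\det _).
apply/matrixP => i j; rewrite !mxE horner_prod.
by apply: eq_bigr => p _; rewrite !hornerE.
Qed.

(* The quotient is taken in the integral domain Q[x][a], where it is unique. *)
Definition factorial_schur lam : QXA lam :=
  xchoose (factorial_schur_exists lam).

Definition twisted_schur (u : nat) (w : nat -> nat) lam : {mpoly rat[d]} :=
  (factorial_schur lam).@[fun l => - ((w l)%:R / u%:R) *: \sum_(i < d) 'X_i].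

End TwistedSchur.

Lemma factorial_schurP (d : nat) (lam : d.-tuple nat) :
  factorial_schur lam * factorial_schur_den lam = factorial_schur_num lam.
Proof. exact/eqP/(xchooseP (factorial_schur_exists lam)). Qed.

(* A finite-dimensional algebraic representation of GL_d(K), in coordinates.
   GL_d(K) is the set [unitmx]; the values of [rep_mx] off it are irrelevant.
   The regular functions on GL_d(K) are the P(g_11, ..., g_dd) / det(g)^k. *)
Record gl_rep (K : fieldType) (d : nat) := GLRep {
  rep_dim : nat;
  rep_mx :> 'M[K]_d -> 'M[K]_rep_dim;
  rep_mx1 : rep_mx 1%:M = 1%:M;
  rep_mxM : {in unitmx &, forall g h, rep_mx (g *m h) = rep_mx g *m rep_mx h};
  rep_algebraic : forall i j, exists (P : {mpoly K[d * d]}) (k : nat),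
    {in unitmx, forall g, rep_mx g i j = P.@[mxvec g 0] / \det g ^+ k}
}.

Definition rep_char (K : fieldType) (d : nat) (V : gl_rep K d) (x : 'rV[K]_d) : K :=
  \tr (V (diag_mx x)).

(* The character is a function on the diagonal torus; K is infinite, so it
   determines a polynomial with rational coefficients. *)
Definition is_character (K : numFieldType) (d : nat) (V : gl_rep K d)
    (p : {mpoly rat[d]}) : Prop :=
  forall x : 'rV[K]_d, (forall i, x 0 i != 0) ->
    rep_char V x = (map_mpoly ratr p).@[x 0].

(* Main.v *)
From HB Require Import structures.
From mathcomp Require Import fingroup perm zify ring.
From mathcomp Require Import mxtens.
Require Import Defs.
Import Order.TTheory Num.Theory.
Local Open Scope ring_scope.

Set Implicit Arguments.
Unset Strict Implicit.
Unset Printing Implicit Defensive.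

(** Write e1 = x_1 + ... + x_d.  At a_l = - w_l e1 the numerator of the
    factorial Schur polynomial has entries prod_(p < m) (x_j + w_p e1) with
    m = lambda_i + d - i.  Switching the weights on one at a time, each step
    replaces some rows of index m by themselves plus w_r e1 times the row of
    index m - 1; expanding by multilinearity, s^w_lambda is a combination with
    natural coefficients of products e1^k s_mu, and these are characters once
    the Schur polynomials are.

    The representation with character s_lambda is cut out of tensor powers of
    K^d by induction on the size of lambda, as the image of an idempotent
    commuting with GL_d.  If f is a character and Delta the Vandermonde product,
    the trace of the Casimir operator on the same representation is, up to a
    scalar shift, Delta^-1 L (Delta f), where L = sum_i (x_i d/dx_i)^2.  The
    antisymmetrised monomials a_nu = s_mu Delta are eigenvectors of L, of
    eigenvalue |nu|^2, and the constituents a_(nu + eps_i) of e1 a_nu have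
    pairwise distinct eigenvalues: a polynomial in the Casimir operator projects
    V^mu (x) K^d on the part of character s_(mu + eps_i). *)

(** * Alternants *)

Section Alternants.

Variables (A : comNzRingType) (d : nat).
Implicit Types (nu : 'I_d -> nat) (p q f : {mpoly A[d]}).

Definition vdm : {mpoly A[d]} :=
  \prod_(i < d) \prod_(j < d | (i < j)%N) ('X_i - 'X_j).

Definition alternant nu : {mpoly A[d]} := \det (\matrix_(i, j) 'X_j ^+ nu i).

Lemma det_reindex (R : comNzRingType) n (s : 'S_n) (M : 'M[R]_n) :
  \det (\matrix_(i, j) M (s i) (s j)) = \det M.
Proof.
have -> : \matrix_(i, j) M (s i) (s j) = row_perm s (col_perm s M).
  by apply/matrixP => i j; rewrite !mxE.
rewrite row_permE col_permE !det_mulmx !det_perm mulrCA -signr_addb.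
by rewrite odd_permV addbb mulr1.
Qed.

(** [Vandermonde] has increasing exponents; reversing rows and columns together costs no sign. *)
Lemma alternant_rho : alternant (fun i => d.-1 - i)%N = vdm.
Proof.
have revP (i : 'I_d) : (rev_ord i = d.-1 - i :> nat)%N.
  by rewrite /=; lia.
rewrite /alternant -(det_reindex (perm (@rev_ord_inj d))).
have -> : \matrix_(i, j) (\matrix_(i0, j0) 'X_j0 ^+ (d.-1 - i0))
      (perm (@rev_ord_inj d) i) (perm (@rev_ord_inj d) j)
    = Vandermonde d (\row_j 'X_(rev_ord j)) :> 'M[{mpoly A[d]}]_d.
  apply/matrixP => i j; rewrite !mxE !permE; congr (_ ^+ _).
  by rewrite -revP rev_ordK.
rewrite det_Vandermonde /vdm.
rewrite (reindex_inj rev_ord_inj) /=.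
under eq_bigr => i _ do rewrite (reindex_inj rev_ord_inj) /=.
rewrite (exchange_big_dep predT) //=.
apply: eq_bigr => i _; apply: eq_big => j; last by rewrite !mxE !rev_ordK.
by have := ltn_ord i; have := ltn_ord j; lia.
Qed.

Lemma alternant_eq nu1 nu2 : nu1 =1 nu2 -> alternant nu1 = alternant nu2.
Proof. by move=> e; congr (\det _); apply/matrixP => i j; rewrite !mxE e. Qed.

Lemma alternantE nu :
  alternant nu = \sum_(s : 'S_d) (-1) ^+ s *: 'X_[[multinom nu (s^-1%g i) | i < d]].
Proof.
rewrite /alternant /determinant; apply: eq_bigr => s _.
rewrite -mul_mpolyC rmorphXn rmorphN rmorph1; congr (_ * _).
rewrite mpolyXE_id [RHS](reindex_inj (@perm_inj _ s)) /=.
by apply: eq_bigr => i _; rewrite !mxE mnmE permK.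
Qed.

(** Pieri's rule for one box: in the term of a permutation s, the factor x_(s k) raises the exponent
    coming from row k. *)
Lemma sum_varM_alternant nu :
  (\sum_(i < d) 'X_i) * alternant nu
  = \sum_(k < d) alternant (fun i => nu i + (i == k))%N.
Proof.
under [RHS]eq_bigr => k _ do rewrite /alternant /determinant.
rewrite exchange_big /= mulr_sumr; apply: eq_bigr => s _.
rewrite mulrCA -mulr_sumr; congr (_ * _).
rewrite mulr_suml (reindex_inj (@perm_inj _ s)) /=; apply: eq_bigr => k _.
under [RHS]eq_bigr => i _ do rewrite mxE exprD.
rewrite big_split /= mulrC; congr (_ * _); first by apply: eq_bigr => i _; rewrite mxE.
rewrite (bigD1 k) //= eqxx big1 ?mulr1 // => i /negPf ->.
by rewrite expr0.
Qed.

(** The Euler operator x_k d/dx_k, diagonal on monomials; [lap] is the operator L. *)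
Definition theta (k : 'I_d) f := 'X_k * f^`M(k).
Definition lap f := \sum_k theta k (theta k f).

Fact theta_is_linear k : linear (theta k).
Proof. by move=> c p q; rewrite /theta linearP /= mulrDr scalerAr. Qed.
HB.instance Definition _ k :=
  GRing.isLinear.Build A {mpoly A[d]} {mpoly A[d]} _ (theta k) (theta_is_linear k).

Fact lap_is_linear : linear lap.
Proof.
move=> c p q; rewrite /lap scaler_sumr -big_split /=.
by apply: eq_bigr => k _; rewrite !linearP.
Qed.
HB.instance Definition _ :=
  GRing.isLinear.Build A {mpoly A[d]} {mpoly A[d]} _ lap lap_is_linear.

Lemma thetaM k p q : theta k (p * q) = theta k p * q + p * theta k q.
Proof. by rewrite /theta mderivM; ring. Qed.

Lemma thetaX k m : theta k 'X_[m] = (m k)%:R *: 'X_[m].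
Proof.
rewrite /theta mderivX -scalerAr -mpolyXD.
have [->|mk0] := eqVneq (m k) 0%N; first by rewrite !scale0r.
by rewrite addmC submK // lep1mP.
Qed.

Lemma thetaXU k i : theta k 'X_i = (i == k)%:R *: 'X_i.
Proof. by rewrite thetaX mnm1E. Qed.

Lemma lapM p q :
  lap (p * q) = lap p * q + (\sum_k theta k p * theta k q) *+ 2 + p * lap q.
Proof.
rewrite /lap mulr_suml mulr_sumr -sumrMnl -!big_split /=.
by apply: eq_bigr => k _; rewrite thetaM linearD /= !thetaM; ring.
Qed.

(** The exponents of every monomial of an alternant are a permutation of [nu], so all have the same
    sum of squares. *)
Lemma lap_alternant nu : lap (alternant nu) = (\sum_i nu i ^ 2)%N%:R *: alternant nu.
Proof.
rewrite alternantE linear_sum scaler_sumr /=; apply: eq_bigr => s _.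
rewrite linearZ scalerA [X in X *: _]mulrC -scalerA /=; congr (_ *: _).
rewrite /lap natr_sum scaler_suml.
rewrite (reindex_inj (@perm_inj _ s)) /=; apply: eq_bigr => k _.
by rewrite thetaX linearZ /= thetaX scalerA mnmE permK -natrM.
Qed.

(* The [h]-terms make up the defect of the Leibniz rule for [lap] on
   [vdm * f]; peeling the factors of [vdm] off one by one avoids dividing
   by them. *)
Lemma sum_theta_vdm f (h : 'I_d -> 'I_d -> {mpoly A[d]}) :
    (forall i j, i != j ->
       ('X_i - 'X_j) * h i j = ('X_i + 'X_j) * (theta i f - theta j f)) ->
  (\sum_k theta k vdm * theta k f) *+ 2
  = vdm * \sum_(i < d) \sum_(j < d | (i < j)%N) (h i j + (theta i f + theta j f)).
Proof.
move=> hP; rewrite /vdm !pair_big_dep /=.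
pose lt2 (p : 'I_d * 'I_d) := (p.1 < p.2)%N.
rewrite -!(big_filter _ lt2).
have : all lt2 [seq p <- index_enum ('I_d * 'I_d)%type | lt2 p] by exact: filter_all.
elim: [seq _ <- _ | _] => [_|[i j] s IHs /= /andP[ltij /IHs {}IHs]].
  rewrite !big_nil mulr0 big1 ?mul0rn // => k _.
  by rewrite /theta -mpolyC1 mderivC mulr0 mul0r.
rewrite !big_cons /=; set D := \prod_(_ <- s) _ in IHs *.
have E k : theta k (('X_i - 'X_j) * D) * theta k f
    = ((i == k)%:R *: 'X_i * (D * theta k f) - (j == k)%:R *: 'X_j * (D * theta k f))
      + ('X_i - 'X_j) * (theta k D * theta k f).
  by rewrite thetaM linearB /= !thetaXU; ring.
rewrite (eq_bigr _ (fun k _ => E k)).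
rewrite big_split /= sumrB -mulr_sumr mulrnDl -mulrnAr IHs.
have sum1 (l : 'I_d) : \sum_k (l == k)%:R *: 'X_l * (D * theta k f) = 'X_l * D * theta l f.
  rewrite (bigD1 l) //= eqxx scale1r big1 ?addr0 ?mulrA // => k.
  by rewrite eq_sym => /negPf ->; rewrite scale0r mul0r.
rewrite !sum1.
have neij : i != j by rewrite neq_ltn (ltij : (i < j)%N).
(* With t_i = [theta i f], the identity behind this is 2 (x_i t_i - x_j t_j) = (x_i - x_j)(t_i +
   t_j) + (x_i + x_j)(t_i - t_j). The term added to both sides gives [hP] a copy to rewrite. *)
apply: (addIr (D * (('X_i - 'X_j) * h i j))); rewrite [in RHS](hP i j neij); ring.
Qed.

(** [vdm] is itself an alternant, hence an eigenvector of [lap]: this yields the scalar term, and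
    [sum_theta_vdm] the mixed one. *)
Lemma lap_vdmM f (h : 'I_d -> 'I_d -> {mpoly A[d]}) :
    (forall i j, i != j ->
       ('X_i - 'X_j) * h i j = ('X_i + 'X_j) * (theta i f - theta j f)) ->
  lap (vdm * f) = vdm * (lap f
    + \sum_(i < d) \sum_(j < d | (i < j)%N) (h i j + (theta i f + theta j f))
    + (\sum_(i < d) (d.-1 - i) ^ 2)%N%:R *: f).
Proof.
move=> hP; rewrite lapM (sum_theta_vdm hP) -alternant_rho lap_alternant.
by rewrite -scalerAl [in RHS]mulrDr -scalerAr; ring.
Qed.

End Alternants.

(** * Representations with a weight basis *)

Section Tensmx.
Variable R : comNzRingType.

Lemma tensmxDl m n p q (A B : 'M[R]_(m, n)) (C : 'M_(p, q)) :
  (A + B) *t C = A *t C + B *t C.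
Proof. by apply/matrixP => i j; rewrite !mxE mulrDl. Qed.

Lemma tensmxDr m n p q (A : 'M[R]_(m, n)) (B C : 'M_(p, q)) :
  A *t (B + C) = A *t B + A *t C.
Proof. by apply/matrixP => i j; rewrite !mxE mulrDr. Qed.

Lemma tensmxZl m n p q a (A : 'M[R]_(m, n)) (B : 'M_(p, q)) :
  (a *: A) *t B = a *: (A *t B).
Proof. by apply/matrixP => i j; rewrite !mxE mulrA. Qed.

Lemma tensmxZr m n p q a (A : 'M[R]_(m, n)) (B : 'M_(p, q)) :
  A *t (a *: B) = a *: (A *t B).
Proof. by apply/matrixP => i j; rewrite !mxE mulrCA. Qed.

Lemma tensmxM m n (A C : 'M[R]_m) (B D : 'M_n) :
  (A *t B) * (C *t D) = (A * C) *t (B * D).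
Proof. exact: tensmx_mul. Qed.

Lemma tensmx_suml m n p q I r (P : pred I) (F : I -> 'M[R]_(m, n)) (B : 'M_(p, q)) :
  (\sum_(i <- r | P i) F i) *t B = \sum_(i <- r | P i) F i *t B.
Proof.
apply: (big_morph (fun X => X *t B)); last exact: tens0mx.
by move=> X Y; rewrite tensmxDl.
Qed.

Lemma tensmx_sumr m n p q I r (P : pred I) (A : 'M[R]_(m, n)) (F : I -> 'M_(p, q)) :
  A *t (\sum_(i <- r | P i) F i) = \sum_(i <- r | P i) A *t F i.
Proof.
apply: (big_morph (fun X => A *t X)); last exact: tensmx0.
by move=> X Y; rewrite tensmxDr.
Qed.

Lemma tensmx11 m n : (1 : 'M[R]_m) *t (1 : 'M[R]_n) = 1.
Proof.
apply/matrixP => i j; case: (mxtens_indexP i) => i1 i2; case: (mxtens_indexP j) => j1 j2.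
rewrite tensmxE !mxE (can_eq (@mxtens_indexK _ _)) xpair_eqE.
by case: eqP; case: eqP; rewrite ?mulr0n ?mul0r ?mulr0 ?mulr1.
Qed.

(** Operators on different tensor factors commute, so the mixed products cancel; hence the Leibniz
    rule defines a Lie algebra action on a tensor product. *)
Lemma tensmx_comm m n (A C : 'M[R]_m) (B D : 'M[R]_n) :
  (A *t 1 + 1 *t B) * (C *t 1 + 1 *t D) - (C *t 1 + 1 *t D) * (A *t 1 + 1 *t B)
  = (A * C - C * A) *t 1 + 1 *t (B * D - D * B).
Proof.
have abel (p q r s t u : 'M[R]_(m * n)) :
    (p + q) + (r + s) - ((t + r) + (q + u)) = (p - t) + (s - u).
  rewrite (addrACA t) opprD addrACA !opprD; congr (_ + _).
    by rewrite addrACA subrr addr0.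
  by rewrite addrACA subrr add0r.
rewrite !mulrDl !mulrDr !tensmxM !mul1r !mulr1 abel -!scaleN1r.
by rewrite !tensmxDl !tensmxDr !(tensmxZl, tensmxZr).
Qed.

Lemma tensmx_diag m n (u : 'rV[R]_m) (v : 'rV[R]_n) :
  diag_mx u *t diag_mx v
  = diag_mx (\row_k (u 0 (mxtens_unindex k).1 * v 0 (mxtens_unindex k).2)).
Proof.
apply/matrixP => i j; case: (mxtens_indexP i) => i1 i2; case: (mxtens_indexP j) => j1 j2.
rewrite tensmxE !mxE mxtens_indexK /= (can_eq (@mxtens_indexK _ _)) xpair_eqE.
by case: eqP; case: eqP; rewrite ?mulr0n ?mul0r ?mulr0.
Qed.

Lemma mxtrace_tens m n (A : 'M[R]_m) (B : 'M[R]_n) : \tr (A *t B) = \tr A * \tr B.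
Proof.
rewrite /mxtrace mulr_suml; under [RHS]eq_bigr => i _ do rewrite mulr_sumr.
rewrite pair_bigA /= (reindex (@mxtens_index m n)) /=.
  by apply: eq_bigr => -[i j] _; rewrite tensmxE.
by exists (@mxtens_unindex m n) => k _; rewrite ?mxtens_indexK ?mxtens_unindexK.
Qed.

End Tensmx.

Lemma sum_offdiag (V : zmodType) n (F : 'I_n -> 'I_n -> V) :
  \sum_i \sum_j F i j
  = \sum_i F i i + \sum_(i < n) \sum_(j < n | (i < j)%N) (F i j + F j i).
Proof.
under [X in _ = _ + X]eq_bigr => i _ do rewrite big_split /=.
rewrite big_split /= [X in _ + (_ + X)](exchange_big_dep predT) //= -!big_split /=.
apply: eq_bigr => i _; rewrite (bigD1 i) //=; congr (_ + _).
rewrite (bigID (fun j : 'I_n => i < j)%N) /=; congr (_ + _); apply: eq_bigl => j.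
  by rewrite -val_eqE /=; lia.
by rewrite -val_eqE /=; lia.
Qed.

Section WeightRep.
Variables (K : numFieldType) (d : nat).

(* A representation of the monoid of matrices together with its differential
   [wlie i j] at the matrix unit E_ij, in a basis of weight vectors; [wlie_mx]
   is the equivariance rho(g) L(A) = L(B) rho(g) for g A = B g, taken at
   A = E_ij g and B = g E_ij. *)
Record weight_rep := WeightRep {
  wdim : nat;
  wdeg : nat;
  wmx : 'M[K]_d -> 'M[K]_wdim;
  wlie : 'I_d -> 'I_d -> 'M[K]_wdim;
  wwt : 'I_wdim -> 'X_{1..d};
  wmx1 : wmx 1%:M = 1;
  wmxM : forall g h, wmx (g *m h) = wmx g * wmx h;
  wmx_poly : forall a b, exists P : {mpoly K[d * d]},
    forall g, wmx g a b = P.@[mxvec g 0];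
  wmx_diag : forall x : 'rV_d,
    wmx (diag_mx x) = diag_mx (\row_b \prod_i x 0 i ^+ wwt b i);
  wlie_diag : forall i, wlie i i = diag_mx (\row_b (wwt b i)%:R);
  wlie_wt : forall i j a b,
    wlie i j a b != 0 -> (wwt a + U_(j) = wwt b + U_(i))%MM;
  wlie_comm : forall i j k l, wlie i j * wlie k l - wlie k l * wlie i j
    = (j == k)%:R *: wlie i l - (l == i)%:R *: wlie k j;
  wlie_mx : forall (g : 'M_d) i j, \sum_k g k i *: (wlie k j * wmx g)
    = \sum_l g j l *: (wmx g * wlie i l);
  wdegE : forall b, mdeg (wwt b) = wdeg
}.

Program Definition trivial_rep : weight_rep :=
  @WeightRep 1 0 (fun=> 1) (fun _ _ => 0) (fun=> 0%MM) _ _ _ _ _ _ _ _ _.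
Next Obligation. by rewrite mulr1. Qed.
Next Obligation. by exists ((1 : 'M_1) a b)%:MP => g; rewrite mevalC. Qed.
Next Obligation.
apply/matrixP => a b; rewrite !mxE; congr (_ *+ _).
by rewrite big1 // => i _; rewrite mnm0E.
Qed.
Next Obligation. by apply/matrixP => a b; rewrite !mxE mnm0E mul0rn. Qed.
Next Obligation. by move: H; rewrite mxE eqxx. Qed.
Next Obligation. by rewrite !mulr0 !scaler0 subrr. Qed.
Next Obligation. by rewrite !big1 // => k _; rewrite ?mulr0 ?mul0r scaler0. Qed.
Next Obligation. exact: mdeg0. Qed.

Lemma sum_delta_r (F : 'I_d -> K) a : \sum_k F k * (a == k)%:R = F a.
Proof.
rewrite (bigD1 a) //= eqxx mulr1 big1 ?addr0 // => k.
by rewrite eq_sym => /negPf ->; rewrite mulr0.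
Qed.

(** With [sum_row_delta], this gives [wlie_mx] for the standard representation: both of its sides
    become g E_ij g. *)
Lemma sum_col_delta (g : 'M[K]_d) (i j : 'I_d) :
  \sum_k g k i *: delta_mx k j = g *m delta_mx i j.
Proof.
apply/matrixP => a b; rewrite summxE mxE.
under eq_bigr => k _ do rewrite !mxE -mulnb natrM mulrA mulrAC.
under [RHS]eq_bigr => k _ do rewrite !mxE -mulnb natrM mulrA mulrAC [k == _]eq_sym.
rewrite !sum_delta_r.
reflexivity.
Qed.

Lemma sum_row_delta (g : 'M[K]_d) (i j : 'I_d) :
  \sum_l g j l *: delta_mx i l = delta_mx i j *m g.
Proof.
apply/matrixP => a b; rewrite summxE mxE.
under eq_bigr => k _ do rewrite !mxE -mulnb natrM mulrA.
under [RHS]eq_bigr => k _ do rewrite !mxE -mulnb natrM [k == _]eq_sym mulrC mulrA.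
rewrite !sum_delta_r. reflexivity.
Qed.

(** * Tensor product with the standard representation *)

Section Tensor.
Variable W : weight_rep.

Let n := wdim W.
Let rho g := wmx W g *t g.
Let e i j := wlie W i j *t (1 : 'M_d) + (1 : 'M_n) *t delta_mx i j.
Let wt (k : 'I_(n * d)) := (wwt (mxtens_unindex k).1 + U_((mxtens_unindex k).2))%MM.

Lemma tensor_comm i j k l : e i j * e k l - e k l * e i j
  = (j == k)%:R *: e i l - (l == i)%:R *: e k j.
Proof.
rewrite /e tensmx_comm wlie_comm -!mulmxE !mul_delta_mx_cond -!scaler_nat.
rewrite -!scaleN1r !tensmxDl !tensmxDr !(tensmxZl, tensmxZr) !scalerDr.
by rewrite addrACA.
Qed.

Lemma tensor_mx (g : 'M_d) i j : \sum_k g k i *: (e k j * rho g) = \sum_l g j l *: (rho g * e i l).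
Proof.
rewrite /e /rho.
under eq_bigr => k _ do rewrite mulrDl !tensmxM !mul1r scalerDr -tensmxZl -tensmxZr.
under [RHS]eq_bigr => k _ do rewrite mulrDr !tensmxM !mulr1 scalerDr -tensmxZl -tensmxZr.
rewrite !big_split /= -!tensmx_suml -!tensmx_sumr wlie_mx; congr (_ + _ *t _).
under eq_bigr => k _ do rewrite -mulmxE scalemxAl.
under [RHS]eq_bigr => k _ do rewrite -mulmxE scalemxAr.
by rewrite !mulmxE -mulr_suml -mulr_sumr sum_col_delta sum_row_delta !mulmxE mulrA.
Qed.

Lemma tensor_wt i j a b : e i j a b != 0 -> (wt a + U_(j) = wt b + U_(i))%MM.
Proof.
have mAC (m1 m2 m3 : 'X_{1..d}) : (m1 + m2 + m3 = m1 + m3 + m2)%MM.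
  by rewrite -!addmA (addmC m2).
rewrite /wt /e; case: (mxtens_indexP a) => a1 a2; case: (mxtens_indexP b) => b1 b2.
rewrite mxE !tensmxE !mxtens_indexK /= !mxE.
have [->|n1] := eqVneq a2 b2; have [->|n2] := eqVneq a1 b1.
(* When both indices agree, the second summand is nonzero only for i = j, where the claim is
   trivial. *)
- case: (boolP ((b2 == i) && (b2 == j))) => [/andP[/eqP -> /eqP ->] //|].
  by rewrite mulr0 addr0 mulr1 => _ /wlie_wt; rewrite mAC => ->; rewrite mAC.
- by rewrite mulr1 mul0r addr0 => /wlie_wt; rewrite mAC => ->; rewrite mAC.
- rewrite mulr0 add0r mul1r; case: (boolP ((a2 == i) && (b2 == j))); last by rewrite eqxx.
  by case/andP => /eqP -> /eqP -> _; rewrite mAC.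
- by rewrite mulr0 mul0r addr0 eqxx.
Qed.

Lemma tensor_lie_diag i : e i i = diag_mx (\row_b (wt b i)%:R).
Proof.
rewrite /e.
have -> : delta_mx i i = diag_mx (\row_k (k == i)%:R) :> 'M[K]_d.
  apply/matrixP => a b; rewrite !mxE.
  have [->|nab] := eqVneq a b; first by rewrite andbb.
  by have [eai|] := eqVneq a i; rewrite //= -eai eq_sym (negPf nab).
have one_diag m : 1 = diag_mx (\row__ 1) :> 'M[K]_m.
  by apply/matrixP => a b; rewrite !mxE.
rewrite wlie_diag !one_diag !tensmx_diag -raddfD /=; congr diag_mx.
by apply/rowP => k; rewrite !mxE mulr1 mul1r /wt mnmDE mnm1E natrD eq_sym.
Qed.

Lemma tensor_mx_poly a b : exists P : {mpoly K[d * d]},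
  forall g, rho g a b = P.@[mxvec g 0].
Proof.
rewrite /rho; case: (mxtens_indexP a) => a1 a2; case: (mxtens_indexP b) => b1 b2.
have [P PE] := wmx_poly a1 b1.
exists (P * 'X_(mxvec_index a2 b2)) => g.
by rewrite tensmxE PE rmorphM /= mevalXU mxvecE.
Qed.

Lemma tensor_diag (x : 'rV_d) :
  rho (diag_mx x) = diag_mx (\row_b \prod_i x 0 i ^+ wt b i).
Proof.
rewrite /rho wmx_diag tensmx_diag; congr diag_mx.
apply/rowP => k; rewrite !mxE /wt; under [RHS]eq_bigr => i _ do rewrite mnmDE exprD.
rewrite big_split /=; congr (_ * _).
rewrite (bigD1 (mxtens_unindex k).2) //= mnm1E eqxx expr1 big1 ?mulr1 // => i.
by rewrite mnm1E eq_sym => /negPf ->.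
Qed.

Program Definition tensor_rep : weight_rep :=
  @WeightRep (n * d) (wdeg W).+1 rho e wt _ _ tensor_mx_poly tensor_diag
    tensor_lie_diag tensor_wt tensor_comm tensor_mx _.
Next Obligation. by rewrite /rho wmx1 tensmx11. Qed.
Next Obligation. by rewrite /rho wmxM mulmxE tensmxM. Qed.
Next Obligation. by rewrite /wt mdegD mdeg1 wdegE addn1. Qed.

End Tensor.
End WeightRep.

(** * The Casimir operator *)

Section Casimir.
Variables (K : numFieldType) (d : nat).
Implicit Types (W : weight_rep K d).

Lemma mxscalerAl n (a : K) (M N : 'M[K]_n) : a *: (M * N) = a *: M * N.
Proof. exact: scalemxAl. Qed.

Lemma mxscalerAr n (a : K) (M N : 'M[K]_n) : a *: (M * N) = M * (a *: N).
Proof. exact: scalemxAr. Qed.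

(** The trace of [M] times the action of diag(x), as a polynomial in x; for a central idempotent it
    is the character of its image. *)
Definition wchar W (M : 'M[K]_(wdim W)) : {mpoly K[d]} := \sum_b M b b *: 'X_[wwt b].

Fact wchar_is_linear W : linear (@wchar W).
Proof.
move=> c M N; rewrite /wchar scaler_sumr -big_split /=.
by apply: eq_bigr => b _; rewrite !mxE scalerDl scalerA.
Qed.
HB.instance Definition _ W :=
  GRing.isLinear.Build K 'M[K]_(wdim W) {mpoly K[d]} _ (@wchar W) (@wchar_is_linear W).

(** The group condition is restricted to invertible matrices because the invariance of the Casimir
    operator is obtained by inverting g. *)
Definition central W (M : 'M[K]_(wdim W)) :=
  {in unitmx, forall g, wmx W g * M = M * wmx W g}
  /\ forall i j, wlie W i j * M = M * wlie W i j.

Lemma central1 W : central (1 : 'M_(wdim W)).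
Proof. by split=> [g _|i j]; rewrite mulr1 mul1r. Qed.

Lemma centralM W (M N : 'M_(wdim W)) : central M -> central N -> central (M * N).
Proof.
move=> [gM eM] [gN eN]; split=> [g gU|i j].
  by rewrite mulrA gM // -mulrA gN // mulrA.
by rewrite mulrA eM -mulrA eN mulrA.
Qed.

Lemma centralX W (M : 'M_(wdim W)) k : central M -> central (M ^+ k).
Proof.
move=> cM; elim: k => [|k IHk]; first exact: central1.
by rewrite exprS; apply: centralM.
Qed.

Lemma centralD W (M N : 'M_(wdim W)) : central M -> central N -> central (M + N).
Proof.
move=> [gM eM] [gN eN]; split=> [g gU|i j].
  by rewrite mulrDl mulrDr gM // gN.
by rewrite mulrDl mulrDr eM eN.
Qed.

Lemma centralZ W a (M : 'M_(wdim W)) : central M -> central (a *: M).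
Proof.
move=> [gM eM]; split=> [g gU|i j].
  by rewrite -mxscalerAr gM // mxscalerAl.
by rewrite -mxscalerAr eM mxscalerAl.
Qed.

Lemma central_sum W I r (P : pred I) (F : I -> 'M_(wdim W)) :
  (forall i, central (F i)) -> central (\sum_(i <- r | P i) F i).
Proof.
move=> cF; apply: big_ind => //; last exact: centralD.
by split=> [g _|i j]; rewrite mulr0 mul0r.
Qed.

Lemma central_tensor W (M : 'M_(wdim W)) :
  central M -> central (M *t 1 : 'M_(wdim (tensor_rep W))).
Proof.
move=> [gM eM]; split=> [g gU|i j] /=.
  by rewrite !tensmxM mulr1 mul1r gM.
by rewrite mulrDl mulrDr !tensmxM !mulr1 !mul1r eM.
Qed.

Lemma wchar_tensor W (M : 'M_(wdim W)) :
  wchar (M *t 1 : 'M_(wdim (tensor_rep W))) = wchar M * \sum_(i < d) 'X_i.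
Proof.
rewrite /wchar mulr_suml; under [RHS]eq_bigr => i _ do rewrite mulr_sumr.
rewrite pair_bigA [RHS]/= (reindex (@mxtens_index (wdim W) d)).
  apply: eq_bigr => -[a i] _; rewrite tensmxE mxE eqxx mulr1.
  pose k := mxtens_index (a, i).
  rewrite -[wwt _]/(wwt (mxtens_unindex k).1 + U_((mxtens_unindex k).2))%MM.
  rewrite mxtens_indexK [in LHS]/=.
  by rewrite mpolyXD scalerAl.
by exists (@mxtens_unindex _ _) => k _; rewrite ?mxtens_indexK ?mxtens_unindexK.
Qed.

Lemma wchar_trace W (M : 'M_(wdim W)) (x : 'rV_d) :
  \tr (M *m wmx W (diag_mx x)) = (wchar M).@[x 0].
Proof.
rewrite wmx_diag mul_mx_diag /mxtrace /wchar linear_sum /=.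
by apply: eq_bigr => b _; rewrite !mxE mevalZ mevalX.
Qed.

Lemma wchar_theta W (M : 'M_(wdim W)) i :
  wchar (M * wlie W i i) = theta i (wchar M).
Proof.
rewrite wlie_diag -mulmxE mul_mx_diag /wchar linear_sum /=.
by apply: eq_bigr => b _; rewrite !mxE linearZ /= thetaX scalerA.
Qed.

(** Cyclicity of the trace: [wlie W i j] shifts weights by eps_i - eps_j, so moving it across
    diag(x) costs a factor x_i / x_j. *)
Lemma wchar_swap W (N : 'M_(wdim W)) i j :
  'X_j * wchar (wlie W i j * N) = 'X_i * wchar (N * wlie W i j).
Proof.
rewrite /wchar !mulr_sumr.
under eq_bigr => b _ do rewrite -mulmxE mxE scaler_suml mulr_sumr.
under [RHS]eq_bigr => b _ do rewrite -mulmxE mxE scaler_suml mulr_sumr.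
rewrite exchange_big /=; apply: eq_bigr => b _; apply: eq_bigr => a _.
have [->|/wlie_wt e] := eqVneq (wlie W i j a b) 0.
  by rewrite mul0r mulr0 !scale0r !mulr0.
by rewrite mulrC -!scalerAr -scalerAl -!mpolyXD e addmC mulrC.
Qed.

(* The scalar is the one that turns the trace of the Casimir operator into [lap]
   conjugated by [vdm]: see [wchar_casimir]. *)
Definition casimir W : 'M_(wdim W) :=
  \sum_i \sum_j wlie W i j * wlie W j i
  + (d.-1 * wdeg W + \sum_(i < d) (d.-1 - i) ^ 2)%N%:R *: (1 : 'M[K]_(wdim W)).

Lemma sum_deltaZ (V : lmodType K) (F : 'I_d -> V) l : \sum_i (l == i)%:R *: F i = F l.
Proof.
rewrite (bigD1 l) //= eqxx scale1r big1 ?addr0 // => i.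
by rewrite eq_sym => /negPf ->; rewrite scale0r.
Qed.

(** Contracting [wlie_mx] with the inverse of g isolates one product: L(E_kj) rho(g) = rho(g) L(g^-1
    E_kj g). *)
Lemma wlie_mxV W (g : 'M_d) k j : g \in unitmx ->
  wlie W k j * wmx W g
  = \sum_i \sum_l (invmx g i k * g j l) *: (wmx W g * wlie W i l).
Proof.
move=> gU; have gV m : \sum_i g m i * invmx g i k = (k == m)%:R.
  by have /matrixP/(_ m k) := mulmxV gU; rewrite !mxE eq_sym.
transitivity (\sum_m \sum_i (invmx g i k * g m i) *: (wlie W m j * wmx W g)).
  under eq_bigr => m _.
    rewrite -scaler_suml; under eq_bigr => i _ do rewrite mulrC.
    by rewrite gV; over.
  by rewrite sum_deltaZ.
rewrite exchange_big /=; apply: eq_bigr => i _.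
under eq_bigr => m _ do rewrite -scalerA.
under [RHS]eq_bigr => m _ do rewrite -scalerA.
by rewrite -!scaler_sumr wlie_mx.
Qed.

Lemma casimir_central W : central (casimir W).
Proof.
apply: centralD; last by apply: centralZ; apply: central1.
set e := wlie W; split=> [g gU|k l].
  (* [wlie_mxV] moves the second factor across rho(g), giving the quadruple sum of [G]. Summing over
     k then moves the first factor by [wlie_mx], and the sum over j collapses g^-1 g. *)
  apply: esym; pose G k j i l := (invmx g i j * g k l) *: (e k j * (wmx W g * e i l)).
  have -> : (\sum_i \sum_j e i j * e j i) * wmx W g = \sum_i \sum_l \sum_j \sum_k G k j i l.
    transitivity (\sum_k \sum_j \sum_i \sum_l G k j i l).
      rewrite mulr_suml; apply: eq_bigr => k _; rewrite mulr_suml; apply: eq_bigr => j _.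
      rewrite -mulrA wlie_mxV // mulr_sumr; apply: eq_bigr => i _.
      by rewrite mulr_sumr; apply: eq_bigr => l _; rewrite -mxscalerAr.
    under [RHS]eq_bigr => i _ do rewrite exchange_big.
    rewrite exchange_big [RHS]exchange_big /=; apply: eq_bigr => j _.
    by rewrite exchange_big /=; apply: eq_bigr => i _; rewrite exchange_big.
  rewrite exchange_big mulr_sumr; apply: eq_bigr => l _.
  rewrite mulr_sumr; apply: eq_bigr => i _.
  transitivity (\sum_j \sum_m (invmx g i j * g j m) *: (wmx W g * e l m * e i l)).
    apply: eq_bigr => j _.
    transitivity (invmx g i j *: ((\sum_k g k l *: (e k j * wmx W g)) * e i l)).
      rewrite mulr_suml scaler_sumr; apply: eq_bigr => k _.
      by rewrite /G -mxscalerAl scalerA mulrA.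
    rewrite wlie_mx mulr_suml scaler_sumr; apply: eq_bigr => m _.
    by rewrite -mxscalerAl scalerA.
  rewrite exchange_big /=.
  under eq_bigr => m _.
    rewrite -scaler_suml; have -> : \sum_j invmx g i j * g j m = (i == m)%:R.
      by have /matrixP/(_ i m) := mulVmx gU; rewrite !mxE.
    over.
  by rewrite sum_deltaZ mulrA.
have comm_mul (x y z : 'M_(wdim W)) :
    x * (y * z) - y * z * x = (x * y - y * x) * z + y * (x * z - z * x).
  by rewrite mulrBl mulrBr !mulrA addrA subrK.
(* The bracket is a derivation. After the Kronecker deltas are summed away, four single sums remain
   and cancel in pairs. *)
apply/eqP; rewrite -subr_eq0 mulr_suml mulr_sumr -sumrB.
under eq_bigr => i _.
  rewrite mulr_suml mulr_sumr -sumrB.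
  under eq_bigr => j _ do
    rewrite comm_mul !wlie_comm (eq_sym j) (eq_sym i) mulrBl mulrBr -!mxscalerAl -!mxscalerAr.
  rewrite big_split /= !sumrB !sum_deltaZ; over.
rewrite big_split /= !sumrB exchange_big /=.
under eq_bigr => j _ do rewrite sum_deltaZ.
rewrite [X in _ + (_ - X)]exchange_big /=.
under [X in _ + (_ - X)]eq_bigr => i _ do rewrite sum_deltaZ.
by rewrite addrA subrK subrr.
Qed.

(** The radial part of the Casimir operator. Its diagonal terms give [lap]; each pair i < j gives
    [h i j], which satisfies the hypothesis of [lap_vdmM] because [E_ij, E_ji] = E_ii - E_jj and the
    trace is cyclic. *)
Lemma wchar_casimir W (M : 'M_(wdim W)) : central M ->
  vdm K d * wchar (M * casimir W) = lap (vdm K d * wchar M).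
Proof.
move=> [gM eM].
pose h i j := wchar (M * (wlie W i j * wlie W j i)) + wchar (M * (wlie W j i * wlie W i j)).
have hP i j : i != j -> ('X_i - 'X_j) * h i j
    = ('X_i + 'X_j) * (theta i (wchar M) - theta j (wchar M)).
  move=> neij; rewrite -!wchar_theta -linearB /= -mulrBr.
  have <- : wlie W i j * wlie W j i - wlie W j i * wlie W i j = wlie W i i - wlie W j j.
    by rewrite wlie_comm !eqxx !scale1r.
  rewrite mulrBr linearB /= /h.
  have := wchar_swap (wlie W j i * M) i j.
  rewrite [in wlie W j i * M * _]eM -[M * _ * _]mulrA eM [wlie W i j * _]mulrA eM -[M * _ * _]mulrA.
  set a := wchar _; set b := wchar _ => sw.
  (* The claim amounts to twice the equation x_j a = x_i b of [sw]. *)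
  by apply: (addIr ('X_j * a *+ 2)); rewrite [in RHS]sw; ring.
rewrite (lap_vdmM hP); congr (_ * _).
rewrite /casimir sum_offdiag !mulrDr !mulr_sumr !linearD !(linear_sum (@wchar W)) /= -!addrA.
congr (_ + _).
  by apply: eq_bigr => i _; rewrite mulrA !wchar_theta.
rewrite -mxscalerAr mulr1 linearZ /= natrD scalerDl addrA; congr (_ + _).
under [in RHS]eq_bigr => i _ do rewrite big_split /=.
rewrite big_split /=; congr (_ + _).
  apply: eq_bigr => i _; rewrite mulr_sumr (linear_sum (@wchar W)).
  by apply: eq_bigr => j _; rewrite mulrDr linearD.
have sum_theta : \sum_(i < d) theta i (wchar M) = (wdeg W)%:R *: wchar M.
  rewrite /wchar; under eq_bigr => i _ do rewrite linear_sum.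
  rewrite exchange_big scaler_sumr /=; apply: eq_bigr => b _.
  rewrite scalerA mulrC -scalerA -(wdegE b) mdegE natr_sum scaler_suml scaler_sumr.
  by apply: eq_bigr => i _; rewrite linearZ /= thetaX.
(* By homogeneity, summing [theta i] over all pairs (i, j) gives d times the degree; removing the
   diagonal leaves d - 1 times the degree for the pairs i < j. *)
have := sum_offdiag (fun i _ : 'I_d => theta i (wchar M)).
rewrite exchange_big /= sum_theta sumr_const card_ord.
have [d0 _|d_gt0] := posnP d.
  have -> : (d.-1 * wdeg W = 0)%N by rewrite [X in X.-1]d0.
  by rewrite scale0r big1 // => i _; have := ltn_ord i; rewrite [X in (_ < X)%N]d0.
have -> (p : {mpoly K[d]}) : p *+ d = p + p *+ d.-1 by rewrite -mulrS prednK.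
by move=> /addrI <-; rewrite natrM -scalerA !scaler_nat.
Qed.

End Casimir.

(** * Existence of the Schur representations *)

Section SpectralProjection.
Variable K : fieldType.

(* [horner_mx] is restricted to sizes of the form [n.+1]. *)
Definition poly_mx n (C : 'M[K]_n) (P : {poly K}) : 'M_n :=
  \sum_(i < size P) P`_i *: C ^+ i.

Lemma poly_mx_horner n (C : 'M[K]_n.+1) P : poly_mx C P = horner_mx C P.
Proof.
rewrite -{2}[P]coefK poly_def rmorph_sum /=; apply: eq_bigr => i _.
by rewrite linearZ rmorphXn /= horner_mx_X.
Qed.

(* [P] is a Bezout cofactor of the part prime to [c k] of the characteristic
   polynomial times all ['X - c j]. *)
Lemma spectral_projection n (C : 'M[K]_n) d (c : 'I_d -> K) k : injective c ->
  exists P : {poly K}, [/\ P.[c k] = 1, forall j, j != k -> P.[c j] = 0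
    & poly_mx C P * poly_mx C P = poly_mx C P].
Proof.
move=> c_inj.
(* The second factor makes every c j a root, whether or not it is an eigenvalue of [C]. *)
pose F := char_poly C * \prod_j ('X - (c j)%:P).
have F0 : F != 0 by rewrite mulf_neq0 ?monic_neq0 ?char_poly_monic ?monic_prod_XsubC.
have Fc j : F.[c j] = 0.
  by rewrite /F hornerM horner_prod (bigD1 j) //= hornerXsubC subrr mul0r mulr0.
have [m [G]] := multiplicity_XsubC F (c k); rewrite F0 /= => Gk FG.
have m_gt0 : (0 < m)%N.
  have := Fc k; rewrite FG; case: m {FG} => // /eqP.
  by rewrite expr0 mulr1 -/(root G _) (negPf Gk).
have : coprimep G (('X - (c k)%:P) ^+ m).
  by apply: coprimep_expr; rewrite coprimep_XsubC.
case/Bezout_eq1_coprimepP => -[u v] /= uv.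
exists (u * G); split.
- have /(congr1 (fun p => p.[c k])) := uv.
  by rewrite !hornerE subrr expr0n gtn_eqF // mulr0 addr0.
- move=> j njk; have := Fc j; rewrite FG !hornerE.
  move/eqP; rewrite mulf_eq0 expf_eq0 subr_eq0 (inj_eq c_inj) (negPf njk) andbF orbF.
  by move/eqP ->; rewrite mulr0.
case: n => [|n] in C F F0 Fc FG *; first by rewrite [LHS]flatmx0 [RHS]flatmx0.
rewrite !poly_mx_horner -rmorphM /=; apply/eqP; rewrite -subr_eq0 -rmorphB /=.
(* By the Bezout relation, u G (u G - 1) is a multiple of [F], which vanishes at [C] by
   Cayley-Hamilton. *)
have -> : u * G * (u * G) - u * G = - (u * v) * F.
  have -> : u * G * (u * G) - u * G = u * G * (u * G - (u * G + v * ('X - (c k)%:P) ^+ m)).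
    by rewrite uv; ring.
  by rewrite FG; ring.
by rewrite rmorphM /= /F rmorphM /= Cayley_Hamilton mul0r mulr0.
Qed.

End SpectralProjection.

Section SchurExistence.
Variables (K : numFieldType) (d : nat).
Implicit Types W : weight_rep K d.

Lemma casimirC W (M : 'M_(wdim W)) : central M -> casimir W * M = M * casimir W.
Proof.
case=> _ eM; rewrite mulrDl mulrDr -mxscalerAl -mxscalerAr mulr1 mul1r.
congr (_ + _); rewrite mulr_suml mulr_sumr; apply: eq_bigr => i _.
rewrite mulr_suml mulr_sumr; apply: eq_bigr => j _.
by rewrite -mulrA eM !mulrA eM.
Qed.

(** Raising mu_k by one increases the sum of squares by 2 mu_k + 1, which determines k. *)
Lemma casimir_eigenvalue_inj (mu : 'I_d -> nat) : injective mu ->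
  injective (fun k => (\sum_i (mu i + (i == k)) ^ 2)%N%:R : K).
Proof.
have E k : (\sum_i (mu i + (i == k)) ^ 2 = \sum_i mu i ^ 2 + (2 * mu k + 1))%N.
  rewrite (bigD1 k) //= [in RHS](bigD1 k) //= eqxx.
  under eq_bigr => i /negPf -> do rewrite addn0.
  by lia.
by move=> mu_inj j k /eqP; rewrite eqr_nat !E => /eqP e; apply: mu_inj; lia.
Qed.

(** [E] is [F *t 1] times a polynomial P in the Casimir operator. Diagonalisability is not asked
    for: by [chFC], P multiplies each alternant [A j] by P(c j), and P is chosen to be 1 at c k and
    0 at the other c j. *)
Lemma schur_step W (F : 'M_(wdim W)) (mu : 'I_d -> nat) k : injective mu ->
    central F -> F * F = F -> vdm K d * wchar F = alternant K mu ->
  exists E : 'M_(wdim (tensor_rep W)), [/\ central E, E * E = E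
    & vdm K d * wchar E = alternant K (fun i => mu i + (i == k))%N].
Proof.
move=> mu_inj cF FF chF; set T := tensor_rep W.
pose c j : K := (\sum_i (mu i + (i == j)) ^ 2)%N%:R.
pose F' : 'M_(wdim T) := F *t 1.
have cF' : central F' by apply: central_tensor.
have cC : central (casimir T) by apply: casimir_central.
pose A j := alternant K (fun i => mu i + (i == j))%N.
have chFC q : vdm K d * wchar (F' * casimir T ^+ q) = \sum_j c j ^+ q *: A j.
  elim: q => [|q IHq].
    rewrite expr0 mulr1 wchar_tensor mulrA chF mulrC sum_varM_alternant.
    by apply: eq_bigr => j _; rewrite scale1r.
  rewrite exprSr mulrA wchar_casimir; last by apply: centralM => //; apply: centralX.
  rewrite IHq linear_sum /=; apply: eq_bigr => j _.
  by rewrite linearZ /= lap_alternant scalerA exprSr.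
have c_inj : injective c := casimir_eigenvalue_inj mu_inj.
have [P [Pk Pj PP]] := spectral_projection (casimir T) k c_inj.
have cP : central (poly_mx (casimir T) P).
  by apply: central_sum => i; apply: centralZ; apply: centralX.
exists (F' * poly_mx (casimir T) P); split; first exact: centralM.
  have FP : poly_mx (casimir T) P * F' = F' * poly_mx (casimir T) P.
    rewrite mulr_suml mulr_sumr; apply: eq_bigr => i _.
    rewrite -mxscalerAl -mxscalerAr; congr (_ *: _).
    by apply/commr_sym/commrX/commr_sym/casimirC.
  rewrite mulrA -[F' * _ * F']mulrA FP mulrA -[F' * F' * _ * _]mulrA PP; congr (_ * _).
  by rewrite tensmxM mulr1 FF.
rewrite /poly_mx [F' * _]mulr_sumr (linear_sum (@wchar K d T)) mulr_sumr /=.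
under eq_bigr => i _ do
  rewrite -mxscalerAr linearZ /= -scalerAr chFC scaler_sumr.
rewrite exchange_big -[RHS]/(A k); move: (A) => {A chFC} A.
transitivity (\sum_j P.[c j] *: A j).
  apply: eq_bigr => j _; rewrite horner_coef scaler_suml.
  by apply: eq_bigr => i _; rewrite scalerA.
rewrite (bigD1 k) //= Pk scale1r big1 ?addr0 // => j njk.
by rewrite Pj // scale0r.
Qed.

Lemma wchar_trivial : wchar (1 : 'M_(wdim (trivial_rep K d))) = 1.
Proof. rewrite /wchar big_ord1 mxE eqxx scale1r; exact: mpolyX0. Qed.

(** Induction on the sum of [nu], removing one box at a time down to the exponents d - 1 - i of the
    trivial representation. *)
Lemma schur_rep (nu : 'I_d -> nat) :
    (forall i j : 'I_d, (i < j)%N -> (nu j < nu i)%N) ->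
  exists (W : weight_rep K d) (F : 'M_(wdim W)), [/\ central F, F * F = F
    & vdm K d * wchar F = alternant K nu].
Proof.
have [n] := ubnP (\sum_i nu i)%N; elim: n => // n IHn in nu * => le_n nu_decr.
have nu_ge (i : 'I_d) : (d.-1 - i <= nu i)%N.
  have [m] := ubnP (d.-1 - i)%N; elim: m i => // m IHm i le_m.
  have [lt_i|] := ltnP i d.-1; last by rewrite -subn_eq0 => /eqP ->.
  have lt_i1 : (i.+1 < d)%N by lia.
  have := nu_decr i (Ordinal lt_i1) (ltnSn i).
  by have := IHm (Ordinal lt_i1); rewrite /=; lia.
have [/existsP[i0 i0P]|/existsPn rho] := boolP [exists i : 'I_d, nu i != d.-1 - i]%N; last first.
  exists (trivial_rep K d), 1; split; [exact: central1|exact: mulr1|].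
  rewrite wchar_trivial mulr1 -alternant_rho; apply: alternant_eq => i.
  by have := rho i; rewrite negbK => /eqP ->.
(* k is the last nonempty row of the partition. The exponents below it are minimal, so lowering nu_k
   by one keeps them strictly decreasing. *)
case: (@arg_maxnP _ i0 (fun i => nu i != d.-1 - i)%N (fun i => i : nat) i0P) => k kP k_max.
have nu_k : (d.-1 - k < nu k)%N by have := nu_ge k; lia.
pose mu i := (nu i - (i == k))%N.
have muE i : nu i = (mu i + (i == k))%N.
  by rewrite /mu; case: eqP => [->|_]; lia.
have mu_decr (i j : 'I_d) : (i < j)%N -> (mu j < mu i)%N.
  move=> ltij; have := nu_decr i j ltij; rewrite /mu.
  have [eik|_] := eqVneq i k; last by case: eqP; lia.
  have -> /= : (j == k) = false by apply/eqP => ejk; move: ltij; rewrite eik ejk ltnn.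
  have /eqP -> : nu j == (d.-1 - j)%N.
    by apply: contraTT ltij => /k_max /=; rewrite eik -leqNgt.
  by have := ltn_ord j; rewrite eik in ltij *; lia.
have mu_inj : injective mu.
  move=> i j e; apply/val_inj; case: (ltngtP i j) => // /mu_decr; rewrite e ltnn //.
have [|W [F [cF FF chF]]] := IHn mu _ mu_decr.
  have sumE : (\sum_i nu i = \sum_i mu i + 1)%N.
    rewrite (eq_bigr _ (fun i _ => muE i)) big_split /=; congr (_ + _)%N.
    by rewrite (bigD1 k) //= eqxx big1 // => i /negPf ->.
  by rewrite sumE addn1 ltnS in le_n.
have [E [cE EE chE]] := schur_step k mu_inj cF FF chF.
exists (tensor_rep W), E; split; [exact: cE|exact: EE|].
rewrite chE; apply: alternant_eq => i; exact/esym.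
Qed.

End SchurExistence.

(** * Genuine characters and twisted alternants *)

Section Characters.
Variables (K : numFieldType) (d : nat).

Definition genuine (p : {mpoly rat[d]}) := exists V : gl_rep K d, is_character V p.

(** The zero-dimensional representation accounts for determinants that vanish in the expansion. *)
Lemma genuine0 : genuine 0.
Proof.
pose rho (g : 'M[K]_d) : 'M[K]_0 := 0.
have mx1 : rho 1%:M = 1%:M by rewrite [RHS]flatmx0.
have mxM : {in unitmx &, forall g h, rho (g *m h) = rho g *m rho h}.
  by move=> g h _ _; rewrite /rho mulmx0.
have algebraic i j : exists (P : {mpoly K[d * d]}) (k : nat),
    {in unitmx, forall g, rho g i j = P.@[mxvec g 0] / \det g ^+ k} by case: i.
by exists (GLRep mx1 mxM algebraic) => x _; rewrite /rep_char mxtrace0 !raddf0.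
Qed.

Lemma genuineD p q : genuine p -> genuine q -> genuine (p + q).
Proof.
move=> [V Vp] [U Uq].
pose rho g := block_mx (V g) 0 0 (U g).
have mx1 : rho 1%:M = 1%:M by rewrite /rho !rep_mx1 -scalar_mx_block.
have mxM : {in unitmx &, forall g h, rho (g *m h) = rho g *m rho h}.
  move=> g h gU hU; rewrite /rho !rep_mxM // mulmx_block.
  by rewrite !(mul0mx, mulmx0, addr0, add0r).
have algebraic i j : exists (P : {mpoly K[d * d]}) (k : nat),
    {in unitmx, forall g, rho g i j = P.@[mxvec g 0] / \det g ^+ k}.
  rewrite /rho; case: (split_ordP i) => a ->; case: (split_ordP j) => b ->.
  - by have [P [k Pk]] := rep_algebraic a b; exists P, k => g gU; rewrite block_mxEul Pk.
  - by exists 0, 0%N => g _; rewrite block_mxEur mxE meval0 mul0r.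
  - by exists 0, 0%N => g _; rewrite block_mxEdl mxE meval0 mul0r.
  - by have [P [k Pk]] := rep_algebraic a b; exists P, k => g gU; rewrite block_mxEdr Pk.
exists (GLRep mx1 mxM algebraic) => x x0.
by rewrite /rep_char /= mxtrace_block !rmorphD /= -Vp // -Uq.
Qed.

Lemma genuineMn p n : genuine p -> genuine (p *+ n).
Proof.
move=> gp; elim: n => [|n IHn]; first by rewrite mulr0n; apply: genuine0.
by rewrite mulrS; apply: genuineD.
Qed.

Lemma genuine_sum_varM p : genuine p -> genuine ((\sum_(i < d) 'X_i) * p).
Proof.
move=> [V Vp].
pose rho g := V g *t g.
have mx1 : rho 1%:M = 1%:M by rewrite /rho rep_mx1; apply: tensmx11.
have mxM : {in unitmx &, forall g h, rho (g *m h) = rho g *m rho h}.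
  by move=> g h gU hU; rewrite /rho rep_mxM // tensmx_mul.
have algebraic i j : exists (P : {mpoly K[d * d]}) (k : nat),
    {in unitmx, forall g, rho g i j = P.@[mxvec g 0] / \det g ^+ k}.
  rewrite /rho; case: (mxtens_indexP i) => i1 i2; case: (mxtens_indexP j) => j1 j2.
  have [P [k Pk]] := rep_algebraic i1 j1.
  exists (P * 'X_(mxvec_index i2 j2)), k => g gU.
  by rewrite tensmxE Pk // rmorphM /= mevalXU mxvecE mulrAC.
exists (GLRep mx1 mxM algebraic) => x x0.
rewrite /rep_char /= mxtrace_tens !rmorphM /= -Vp // mulrC; congr (_ * _).
rewrite mxtrace_diag [map_mpoly _ _]rmorph_sum [RHS]rmorph_sum; apply: eq_bigr => i _.
by rewrite /= map_mpolyX mevalXU.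
Qed.

(** A rank factorisation F = A B of an idempotent has B A = 1, so B rho(g) A is the action on the
    image of [F]. *)
Lemma gl_rep_image (W : weight_rep K d) (F : 'M_(wdim W)) : central F -> F * F = F ->
  exists V : gl_rep K d, forall x : 'rV_d, (forall i, x 0 i != 0) ->
    rep_char V x = (wchar F).@[x 0].
Proof.
move=> [gF _] FF.
set A := col_base F; set B := row_base F.
have AB : A *m B = F by apply: mulmx_base.
have BA : B *m A = 1%:M.
  apply: (row_full_inj (col_base_full F)); apply: (row_free_inj (row_base_free F)).
  by rewrite /= mulmx1 mulmxA AB -mulmxA AB; exact: FF.
have FA : F *m A = A by rewrite -[RHS]mulmx1 -BA mulmxA AB.
pose rho g := B *m wmx W g *m A.
have mx1 : rho 1%:M = 1%:M by rewrite /rho wmx1 mulmx1.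
have mxM : {in unitmx &, forall g h, rho (g *m h) = rho g *m rho h}.
  move=> g h gU hU; rewrite /rho wmxM -mulmxE.
  rewrite -[RHS]mulmxA [A *m _]mulmxA [A *m _]mulmxA AB.
  have -> : F *m wmx W h *m A = wmx W h *m A.
    by rewrite [F *m _](esym (gF _ hU)) -mulmxE -mulmxA FA.
  by rewrite !mulmxA.
have algebraic i j : exists (P : {mpoly K[d * d]}) (k : nat),
    {in unitmx, forall g, rho g i j = P.@[mxvec g 0] / \det g ^+ k}.
  have /fin_all_exists[P PE] : forall ab : 'I_(wdim W) * 'I_(wdim W),
      exists P : {mpoly K[d * d]}, forall g, wmx W g ab.1 ab.2 = P.@[mxvec g 0].
    by move=> ab; apply: wmx_poly.
  exists (\sum_b \sum_a (B i a * A b j) *: P (a, b)), 0%N => g _.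
  rewrite expr0 divr1 /rho mxE raddf_sum; apply: eq_bigr => b _.
  rewrite mxE mulr_suml raddf_sum; apply: eq_bigr => a _.
  by rewrite -mul_mpolyC /= mevalM mevalC -(PE (a, b)) mulrAC.
exists (GLRep mx1 mxM algebraic) => x x0.
by rewrite /rep_char /= /rho mxtrace_mulC mulmxA AB wchar_trace.
Qed.

End Characters.

(** * Change of coefficient ring *)

Section MapMpoly.
Variables (A B : comNzRingType) (f : {rmorphism A -> B}) (d : nat).

Lemma map_vdm : map_mpoly f (vdm A d) = vdm B d.
Proof.
rewrite /vdm rmorph_prod; apply: eq_bigr => i _.
rewrite rmorph_prod; apply: eq_bigr => j _.
by rewrite rmorphB /= !map_mpolyX.
Qed.

Lemma map_alternant nu : map_mpoly f (alternant A nu) = alternant B nu :> {mpoly B[d]}.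
Proof.
rewrite /alternant -det_map_mx; congr (\det _); apply/matrixP => i j.
by rewrite !mxE rmorphXn /= map_mpolyX.
Qed.

End MapMpoly.

Lemma vdm_neq0 (R : idomainType) d : vdm R d != 0.
Proof.
apply/prodf_neq0 => i _; apply/prodf_neq0 => j ltij.
apply/eqP => /(congr1 (fun p => p@_U_(i))) /eqP.
rewrite mcoeffB !mcoeffXU mcoeff0 eqxx -[j == i]val_eqE /=.
by rewrite gtn_eqF // subr0 oner_eq0.
Qed.

(** * Alternants with the weights switched on one at a time *)

Section TwistedAlternant.
Variables (A : comNzRingType) (d : nat) (w : nat -> nat).

Local Notation e1 := (\sum_(i < d) 'X_i : {mpoly A[d]}).

(* The product over all p < m of x_j + w_p e1, with w_p replaced by 0 for p >= r. *)
Definition twisted_power (r m : nat) (j : 'I_d) : {mpoly A[d]} :=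
  (\prod_(p < minn r m) ('X_j + (w p)%:R *: e1)) * 'X_j ^+ (m - r).

Definition twisted_alternant r nu : {mpoly A[d]} :=
  \det (\matrix_(i, j) twisted_power r (nu i) j).

Lemma twisted_power0 m j : twisted_power 0 m j = 'X_j ^+ m.
Proof. by rewrite /twisted_power min0n big_ord0 mul1r subn0. Qed.

Lemma twisted_power_le r m j : (m <= r)%N ->
  twisted_power r m j = \prod_(p < m) ('X_j + (w p)%:R *: e1).
Proof.
by move=> le_mr; rewrite /twisted_power (minn_idPr le_mr) (eqP le_mr) mulr1.
Qed.

(** Switching on w_r turns one factor x_j into x_j + w_r e1. The extra summand has one factor x_j
    fewer and the same r switched-on factors; for m <= r nothing changes. *)
Lemma twisted_powerS r m j : twisted_power r.+1 m j
  = twisted_power r m j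
    + (if (r < m)%N then (w r)%:R *: e1 else 0) * twisted_power r m.-1 j.
Proof.
case: ltnP => [lt_rm|le_mr]; last first.
  by rewrite mul0r addr0 !twisted_power_le // leqW.
rewrite /twisted_power (minn_idPl lt_rm) (minn_idPl (ltnW lt_rm)).
have le_rm1 : (r <= m.-1)%N by lia.
rewrite (minn_idPl le_rm1) big_ord_recr /= -[in LHS]/(m - r.+1)%N.
have -> : (m - r = (m - r.+1).+1)%N by lia.
have -> : (m.-1 - r = m - r.+1)%N by lia.
by rewrite exprS; ring.
Qed.

Lemma det_rowsD (n : nat) (F G : 'I_n -> 'I_n -> {mpoly A[d]}) :
  \det (\matrix_(i, j) (F i j + G i j))
  = \sum_(b : {ffun 'I_n -> bool})
      \det (\matrix_(i, j) (if b i then G i j else F i j)).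
Proof.
rewrite /determinant exchange_big; apply: eq_bigr => s _.
rewrite -mulr_sumr; congr (_ * _).
pose H i (c : bool) := if c then G i (s i) else F i (s i).
transitivity (\prod_i \sum_c H i c).
  by apply: eq_bigr => i _; rewrite mxE big_bool addrC.
rewrite bigA_distr_bigA; apply: eq_bigr => b _.
by apply: eq_bigr => i _; rewrite mxE.
Qed.

Lemma det_scale_rows n (c : 'I_n -> {mpoly A[d]}) (M : 'M_n) :
  \det (\matrix_(i, j) (c i * M i j)) = (\prod_i c i) * \det M.
Proof.
have -> : \matrix_(i, j) (c i * M i j) = diag_mx (\row_i c i) *m M.
  by rewrite mul_diag_mx; apply/matrixP => i j; rewrite !mxE.
by rewrite det_mulmx det_diag; congr (_ * _); apply: eq_bigr => i _; rewrite mxE.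
Qed.

Lemma twisted_alternantS r nu : twisted_alternant r.+1 nu
  = \sum_(b : {ffun 'I_d -> bool})
      (\prod_i (if b i then if (r < nu i)%N then (w r)%:R *: e1 else 0 else 1))
      * twisted_alternant r (fun i => nu i - b i)%N.
Proof.
rewrite /twisted_alternant.
have -> : \matrix_(i, j) twisted_power r.+1 (nu i) j
    = \matrix_(i, j) (twisted_power r (nu i) j
        + (if (r < nu i)%N then (w r)%:R *: e1 else 0) * twisted_power r (nu i).-1 j).
  by apply/matrixP => i j; rewrite !mxE twisted_powerS.
rewrite det_rowsD; apply: eq_bigr => b _; rewrite -det_scale_rows.
congr (\det _); apply/matrixP => i j; rewrite !mxE.
by case: (b i); rewrite ?subn1 ?subn0 ?mul1r.
Qed.

Lemma twisted_alternant_coincide r nu i j : i != j -> nu i = nu j ->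
  twisted_alternant r nu = 0.
Proof.
move=> neij e; apply: (determinant_alternate neij) => k.
by rewrite !mxE e.
Qed.

(** Permuting the variables permutes the columns. *)
Lemma msym_det (g : 'I_d -> 'I_d -> {mpoly A[d]}) (s : 'S_d) :
    (forall i j, msym s (g i j) = g i (s j)) ->
  msym s (\det (\matrix_(i, j) g i j)) = (-1) ^+ s * \det (\matrix_(i, j) g i j).
Proof.
move=> gs; rewrite -[msym s _]det_map_mx.
have -> : map_mx (msym s) (\matrix_(i, j) g i j) = col_perm s (\matrix_(i, j) g i j).
  by apply/matrixP => i j; rewrite !mxE gs.
by rewrite col_permE det_mulmx det_perm odd_permV mulrC.
Qed.

Lemma msym_varU (s : 'S_d) i : msym s ('X_i : {mpoly A[d]}) = 'X_(s i).
Proof.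
rewrite msymX; congr 'X_[_]; apply/mnmP => j.
by rewrite mnmE !mnm1E -(inj_eq (@perm_inj _ s)) permKV.
Qed.

Lemma msym_vdm (s : 'S_d) : msym s (vdm A d) = (-1) ^+ s * vdm A d.
Proof.
by rewrite -alternant_rho; apply: msym_det => i j; rewrite rmorphXn /= msym_varU.
Qed.

Lemma msym_twisted_alternant r nu (s : 'S_d) :
  msym s (twisted_alternant r nu) = (-1) ^+ s * twisted_alternant r nu.
Proof.
apply: msym_det => i j; rewrite /twisted_power rmorphM rmorph_prod rmorphXn /=.
rewrite msym_varU; congr (_ * _); apply: eq_bigr => p _.
rewrite rmorphD /= msymZ msym_varU; congr (_ + _ *: _).
rewrite rmorph_sum [RHS](reindex_inj (@perm_inj _ s)) /=.
by apply: eq_bigr => k _; rewrite msym_varU.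
Qed.

(** With e1 treated as a constant of the coefficient ring, column j consists of values at x_j of
    univariate polynomials. The quotient exists over any [A], whence integrality. *)
Lemma twisted_alternant_divisible r nu :
  exists p : {mpoly A[d]}, p * vdm A d = twisted_alternant r nu.
Proof.
pose f (i : 'I_d) : {poly {mpoly A[d]}} :=
  (\prod_(p < minn r (nu i)) ('X + ((w p)%:R *: e1)%:P)) * 'X ^+ (nu i - r).
have [p pE] := det_horner_divisible f (fun j => 'X_j).
exists p; rewrite -pE; congr (\det _); apply/matrixP => i j.
rewrite !mxE hornerM horner_prod horner_exp hornerX; congr (_ * _).
by apply: eq_bigr => k _; rewrite hornerD hornerX hornerC.
Qed.

End TwistedAlternant.

Lemma map_twisted_alternant (A B : comNzRingType) (f : {rmorphism A -> B}) d w r nu :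
  map_mpoly f (twisted_alternant A w r nu) = twisted_alternant B w r nu :> {mpoly B[d]}.
Proof.
rewrite /twisted_alternant -det_map_mx; congr (\det _); apply/matrixP => i j.
rewrite !mxE /twisted_power rmorphM rmorph_prod rmorphXn /= map_mpolyX.
congr (_ * _); apply: eq_bigr => p _.
rewrite rmorphD /= map_mpolyX map_mpolyZ rmorph_nat rmorph_sum; congr (_ + _ *: _).
by apply: eq_bigr => k _; rewrite /= map_mpolyX.
Qed.

(** * Characters multiplied by the Vandermonde product *)

Section GenuineQuotients.
Variables (K : numFieldType) (d : nat).

(** Stated on the product with [vdm], so that determinants can be expanded without dividing. *)
Definition genuine_quotient (q : {mpoly rat[d]}) :=
  exists2 p, genuine K p & p * vdm rat d = q.

Lemma genuine_quotient_alternant (nu : 'I_d -> nat) :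
    (forall i j : 'I_d, (i < j)%N -> (nu j < nu i)%N) ->
  genuine_quotient (alternant rat nu).
Proof.
move=> nu_decr; have [W [F [cF FF chF]]] := schur_rep K nu_decr.
have [p pE] := det_horner_divisible (fun i : 'I_d => 'X^(nu i)) (fun j => 'X_j : {mpoly rat[d]}).
have {}pE : p * vdm rat d = alternant rat nu.
  rewrite -[LHS]pE; congr (\det _); apply/matrixP => i j.
  by rewrite !mxE hornerXn.
exists p => //; have [V VF] := gl_rep_image cF FF.
exists V => x x0; rewrite VF //; congr (_.@[x 0]).
apply: (mulfI (vdm_neq0 K d)); rewrite chF mulrC.
by rewrite -(map_vdm (@ratr K)) -rmorphM /= pE map_alternant.
Qed.

Lemma genuine_quotientD q1 q2 :
  genuine_quotient q1 -> genuine_quotient q2 -> genuine_quotient (q1 + q2).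
Proof.
move=> [p1 g1 <-] [p2 g2 <-]; exists (p1 + p2); first exact: genuineD.
by rewrite mulrDl.
Qed.

Lemma genuine_quotient0 : genuine_quotient 0.
Proof. by exists 0; [exact: genuine0|rewrite mul0r]. Qed.

Lemma genuine_quotient_sum_varM n q :
  genuine_quotient q -> genuine_quotient ((n%:R *: \sum_(i < d) 'X_i) * q).
Proof.
move=> [p gp <-]; exists ((\sum_(i < d) 'X_i) * p *+ n).
  by apply/genuineMn/genuine_sum_varM.
by rewrite -scalerAl scaler_nat mulrA mulrnAl.
Qed.

Lemma genuine_quotient_twisted (w : nat -> nat) r (nu : 'I_d -> nat) :
    (forall i j : 'I_d, (i < j)%N -> (nu j < nu i)%N) ->
  genuine_quotient (twisted_alternant rat w r nu).
Proof.
elim: r nu => [|r IHr] nu nu_decr.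
  have -> : twisted_alternant rat w 0 nu = alternant rat nu.
    by congr (\det _); apply/matrixP => i j; rewrite !mxE twisted_power0.
  exact: genuine_quotient_alternant.
rewrite twisted_alternantS; apply: big_ind; [exact: genuine_quotient0|exact: genuine_quotientD|].
move=> b _; set t := twisted_alternant _ _ _ _.
(* A choice [b] lowering a row with nu_i <= r has coefficient 0. Otherwise every lowered nu_i is
   positive, and the subtraction is not truncated. *)
have [/forallP b_nu|] := boolP [forall i, b i ==> (r < nu i)%N]; last first.
  case/forallPn => i; rewrite negb_imply => /andP[bi /negPf ri].
  rewrite (bigD1 i) //= bi ri !mul0r; exact: genuine_quotient0.
have gt : genuine_quotient t.
  (* Lowering entries by at most one leaves the sequence weakly decreasing: either two entries
     coincide and the determinant is 0, or the induction hypothesis applies. *)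
  have [/existsP[i /existsP[j /and3P[ltij neij]]]|/existsPn distinct] :=
    boolP [exists i : 'I_d, exists j : 'I_d, [&& (i < j)%N, i != j & nu i - b i == nu j - b j]%N].
    move=> /eqP e; rewrite /t (twisted_alternant_coincide rat w r neij e).
    exact: genuine_quotient0.
  apply: IHr => i j ltij.
  have := distinct i => /existsPn/(_ j); rewrite ltij -val_eqE /= (ltn_eqF ltij) /=.
  have := nu_decr i j ltij; have := implyP (b_nu i); have := implyP (b_nu j).
  by case: (b i); case: (b j) => /=; lia.
apply: (big_rec (fun c => genuine_quotient (c * t))) => [|i c _ gct]; first by rewrite mul1r.
rewrite -mulrA; case: ifP => _; last by rewrite mul1r.
by case: ifP => _; [apply: genuine_quotient_sum_varM|rewrite mul0r; apply: genuine_quotient0].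
Qed.

End GenuineQuotients.

(** * Specialisation of the factorial Schur polynomial, and conclusion *)

Lemma sorted_geq_nth (s : seq nat) i j : sorted geq s ->
  (i <= j)%N -> (j < size s)%N -> (nth 0 s j <= nth 0 s i)%N.
Proof.
move=> s_sorted le_ij lt_j.
have geq_trans : transitive geq by move=> x y z /= h1 h2; apply: leq_trans h2 h1.
have geq_refl : reflexive geq by move=> x; apply: leqnn.
by apply: (sorted_leq_nth geq_trans geq_refl) => //; rewrite inE // (leq_ltn_trans le_ij).
Qed.

(** At a_p = - w_p e1 the factor x_j - a_p becomes x_j + w_p e1. Since the first part is the
    largest, [num_shifts] bounds every exponent, so all the weights are switched on. *)
Lemma twisted_schurE d (w : nat -> nat) (lam : d.-tuple nat) : sorted geq lam ->
  twisted_schur 1 w lam * vdm rat d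
  = twisted_alternant rat w (num_shifts lam) (fun i => (bar_part lam i).-1).
Proof.
move=> lam_sorted; set v := fun l : 'I_(num_shifts lam) =>
  - ((w l)%:R / 1%:R) *: \sum_(i < d) 'X_i : {mpoly rat[d]}.
have := congr1 (meval v) (factorial_schurP lam).
rewrite mevalM -/(twisted_schur 1 w lam).
have -> : (factorial_schur_den lam).@[v] = vdm rat d.
  rewrite /factorial_schur_den rmorph_prod; apply: eq_bigr => i _.
  by rewrite rmorph_prod; apply: eq_bigr => j _; rewrite rmorphB /= !mevalC.
move=> ->; rewrite /factorial_schur_num -det_map_mx; congr (\det _).
apply/matrixP => i j; rewrite !mxE.
have le_num : ((bar_part lam i).-1 <= num_shifts lam)%N.
  have le_head : (tnth lam i <= head 0%N lam)%N.
    by rewrite (tnth_nth 0%N) -nth0 sorted_geq_nth ?size_tuple.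
  by rewrite /num_shifts /bar_part; lia.
rewrite twisted_power_le // (big_ord_widen _ (fun p => 'X_j + (w p)%:R *: _) le_num).
rewrite rmorph_prod; apply: eq_bigr => p _.
by rewrite rmorphB /= mevalC mevalXU /v divr1 scaleNr opprK.
Qed.

Unset Implicit Arguments.

Theorem theoremB (R : realType) (d : nat) (w : nat -> nat) (lam : d.-tuple nat) :
  (0 < d)%N -> sorted geq lam ->
  (exists2 p : {mpoly int[d]},
     p \is symmetric & map_mpoly intr p = twisted_schur 1 w lam)
  /\ (exists V : gl_rep R[i] d, is_character V (twisted_schur 1 w lam)).
Proof.
move=> _ lam_sorted; have sE := twisted_schurE w lam_sorted.
set nu := fun i => (bar_part lam i).-1 in sE; split.
  have [p pE] := twisted_alternant_divisible int w (num_shifts lam) nu.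
  exists p; last first.
    apply: (mulIf (vdm_neq0 rat d)); rewrite sE.
    by rewrite -(map_vdm (intr : int -> rat)) -rmorphM /= pE map_twisted_alternant.
  (* p [vdm] and [vdm] change by the same sign under s, and [vdm] can be cancelled. *)
  apply/issymP => s; apply: (mulIf (vdm_neq0 int d)).
  have sgn_neq0 : (-1) ^+ s != 0 :> {mpoly int[d]} by rewrite signr_eq0.
  apply: (mulfI sgn_neq0); rewrite mulrCA -msym_vdm -msymM pE.
  exact: msym_twisted_alternant.
have [i j ltij|p gp pE] := @genuine_quotient_twisted R[i] d w (num_shifts lam) nu.
  have := sorted_geq_nth lam_sorted (ltnW ltij); rewrite size_tuple => /(_ (ltn_ord j)).
  by rewrite -!tnth_nth /nu /bar_part; have := ltn_ord j; lia.
by rewrite -(mulIf (vdm_neq0 rat d) (etrans pE (esym sE))).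
Qed.
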